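(* Let $N \geqslant 2$ be an integer, let $\mathcal{D} \subset \{0,1,\ldots,N-1\}^2$ be non-empty, and let $F=F(N,\mathcal{D})$ be the associated fractal square with level-1 graph $G_F$. Suppose $\#\mathscr{C}(\mathcal{D}) \geqslant 2$. Then $\#\mathscr{C}(F)=\#\mathscr{C}(\mathcal{D})$ if and only if $\#\mathscr{C}(G_F)=\#\mathscr{C}(\mathcal{D})$.
   Context: For an integer $N\geqslant 2$ and a non-empty $\mathcal{D} \subset \{0,1,\ldots,N-1\}^2$, put $\varphi_d(x)=(x+d)/N$ for $d\in\mathcal{D}$, $x\in\mathbb{R}^2$. The fractal square $F=F(N,\mathcal{D})$ is the unique non-empty compact set $F\subset\mathbb{R}^2$ with $F=\bigcup_{d\in\mathcal{D}}\varphi_d(F)$. For a set $A\subset\mathbb{R}^2$, $\mathscr{C}(A)$ denotes the collection of connected components of $A$; $\#$ denotes cardinality. A set $\mathcal{A}\subset\mathcal{D}$ is called connected if for any $d,d'\in\mathcal{A}$ there exist $d_1,\ldots,d_n\in\mathcal{A}$ with $d_1=d$, $d_n=d'$ and $\varphi_{d_i}(F)\cap\varphi_{d_{i+1}}(F)\neq\varnothing$ for $1\leqslant i\leqslant n-1$. Maximal (by inclusion) connected subsets of $\mathcal{D}$ are its connected components, and $\mathscr{C}(\mathcal{D})$ is the collection of them. Write $\mathscr{C}(\mathcal{D})=\{\mathcal{D}_1,\ldots,\mathcal{D}_m\}$ and $F_i=\bigcup_{d\in\mathcal{D}_i}\varphi_d(F)$ for $1\leqslant i\leqslant m$. The level-1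 graph $G_F$ has vertex set $\{(d,i): d\in\mathcal{D},\,1\leqslant i\leqslant m\}$, with an edge joining $(d_1,i_1)$ and $(d_2,i_2)$ if and only if $\varphi_{d_1}(F_{i_1})\cap\varphi_{d_2}(F_{i_2})\neq\varnothing$. $\mathscr{C}(G_F)$ is the collection of connected components of $G_F$, regarded as sets of vertices. *)

(* Defs.v *)
From HB Require Import structures.
From mathcomp Require Import all_boot all_order all_algebra.
From mathcomp Require Import all_classical all_reals all_analysis.

Set Implicit Arguments.
Unset Strict Implicit.
Unset Printing Implicit Defensive.

Import Order.TTheory GRing.Theory Num.Theory.
Import numFieldNormedType.Exports.

Local Open Scope classical_set_scope.
Local Open Scope ring_scope.

Definition components (T : topologicalType) (A : set T) : set (set T) :=
  [set connected_component A x | x in A].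

(* Chains are required to stay inside A: [connect] is taken for the relation
   e restricted to A. *)
Definition graph_connected (T : finType) (e : rel T) (A : {set T}) : bool :=
  [forall x in A, forall y in A,
     connect [rel u v | [&& u \in A, v \in A & e u v]] x y].

Definition graph_components (T : finType) (e : rel T) (V : {set T}) :
    {set {set T}} :=
  [set A | maxset (fun B : {set T} => (B \subset V) && graph_connected e B) A].

Section FractalSquare.
Variables (R : realType) (N : nat).

Notation digit := ('I_N * 'I_N)%type.

Definition phi (d : digit) (x : R * R) : R * R :=
  ((x.1 + (d.1 : nat)%:R) / N%:R, (x.2 + (d.2 : nat)%:R) / N%:R).

Definition phi_image (B : {set digit}) (F : set (R * R)) : set (R * R) :=
  \bigcup_(d in [set` B]) (phi d @` F).

(* For N >= 2 and D nonempty, exactly one F satisfies this (Hutchinson). *)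
Definition is_fractal_square (D : {set digit}) (F : set (R * R)) : Prop :=
  [/\ compact F, F !=set0 & F = phi_image D F].

Definition digit_adj (F : set (R * R)) : rel digit :=
  fun d d' => `[< (phi d @` F) `&` (phi d' @` F) !=set0 >].

Definition digit_components (D : {set digit}) (F : set (R * R)) :
    {set {set digit}} :=
  graph_components (digit_adj F) D.

(* A vertex (d, i) is encoded as (d, D_i): the component D_i itself serves as
   its index, so that F_i is phi_image D_i F. *)
Definition level1_vertices (D : {set digit}) (F : set (R * R)) :
    {set digit * {set digit}} :=
  finset.setX D (digit_components D F).

Definition level1_adj (F : set (R * R)) : rel (digit * {set digit}) :=
  fun u v => `[< (phi u.1 @` phi_image u.2 F) `&`
                 (phi v.1 @` phi_image v.2 F) !=set0 >].

Definition level1_components (D : {set digit}) (F : set (R * R)) :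
    {set {set digit * {set digit}}} :=
  graph_components (level1_adj F) (level1_vertices D F).

End FractalSquare.

(* Main.v *)
(* Write F_A for the union of phi_d(F) over d in A. As A ranges over the
   components of the digit set, the F_A are disjoint, compact and nonempty and
   cover F, so F has exactly as many components as there are digit components
   iff every F_A is connected. Likewise edges of the level-1 graph never leave a
   block {(d, B) : d in A}, so the two graph counts agree iff every block is
   connected in that graph. Now F_A is the finite union of the closed tiles
   phi_d(F_B) over its block, and intersection of tiles is adjacency: if F_A is
   connected, so is the block. Conversely, if the blocks are connected and each
   F_B is chain connected by steps smaller than N e, the tiles, and hence each
   F_A, are chain connected by steps smaller than e. As F is bounded, iterating
   this gives chain connectedness at every scale, which for a compact set is
   connectedness. *)

Require Import Defs.
From HB Require Import structures.
From mathcomp Require Import all_boot all_order all_algebra.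
From mathcomp Require Import finmap.
From mathcomp Require Import all_classical all_reals all_analysis.

Set Implicit Arguments.
Unset Strict Implicit.
Unset Printing Implicit Defensive.

Import Order.TTheory GRing.Theory Num.Theory.
Import numFieldNormedType.Exports.

Local Open Scope classical_set_scope.
Local Open Scope ring_scope.
Local Open Scope card_scope.

(** * Components of a finite graph as reachability classes *)

Lemma connect_invariant (T : finType) (e : rel T) (Q : T -> Prop) (x y : T) :
  (forall u v, Q u -> e u v -> Q v) -> connect e x y -> Q x -> Q y.
Proof.
move=> Qe /connectP[p + ->]; elim: p x => //= z p IH x /andP[exz pz] Qx.
exact: IH pz (Qe _ _ Qx exz).
Qed.

Definition induced_rel (T : finType) (e : rel T) (V : {set T}) : rel T :=
  [rel u v | [&& u \in V, v \in V & e u v]].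

Definition graph_class (T : finType) (e : rel T) (V : {set T}) (v : T) :
    {set T} :=
  [set w in V | connect (induced_rel e V) v w]%SET.

Section GraphClasses.
Variables (T : finType) (e : rel T) (V : {set T}).
Hypothesis e_sym : symmetric e.

Lemma induced_connect_sym (A : {set T}) : connect_sym (induced_rel e A).
Proof.
by apply: sym_connect_sym => u v; rewrite /induced_rel /= e_sym andbCA.
Qed.

Lemma mem_graph_class v : v \in V -> v \in graph_class e V v.
Proof. by move=> vV; rewrite inE vV connect0. Qed.

Lemma graph_class_sub v : graph_class e V v \subset V.
Proof. by apply/fintype.subsetP => w; rewrite inE => /andP[]. Qed.

Lemma graph_class_eq v w :
  w \in graph_class e V v -> graph_class e V w = graph_class e V v.
Proof.
rewrite inE => /andP[_ vw]; apply/setP => x; rewrite !inE.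
by rewrite (same_connect (induced_connect_sym V) vw).
Qed.

(** A chain in [V] that starts in the class never leaves it, so it survives the restriction to the
    class that [graph_connected] demands. *)
Lemma graph_class_connected v : graph_connected e (graph_class e V v).
Proof.
apply/forall_inP => x xC; apply/forall_inP => y yC.
have : connect (induced_rel e V) x y.
  move: xC yC; rewrite !inE => /andP[_ vx] /andP[_ vy].
  by rewrite induced_connect_sym in vx; apply: connect_trans vx vy.
pose Q u := u \in graph_class e V v /\
  connect (induced_rel e (graph_class e V v)) x u.
move=> xy; suff : Q y by case.
apply: (connect_invariant _ xy) => // u w [uC xu] uw.
have wC : w \in graph_class e V v.
  move: (uC) (uw); rewrite !inE => /andP[_ vu] /and3P[_ wV _].
  by rewrite wV; apply: connect_trans vu (connect1 uw).
split=> //; apply: connect_trans xu _; apply: connect1 => /=.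
by rewrite /induced_rel /= uC wC; case/and3P: uw.
Qed.

Lemma graph_connected_sub_class (B : {set T}) v :
  B \subset V -> graph_connected e B -> v \in B -> B \subset graph_class e V v.
Proof.
move=> BV /forall_inP Bconn vB; apply/fintype.subsetP => w wB.
rewrite inE (fintype.subsetP BV)//=; move/forall_inP: (Bconn _ vB) => /(_ _ wB).
apply: connect_sub => x y /= /and3P[xB yB exy]; apply: connect1 => /=.
by rewrite /induced_rel /= !(fintype.subsetP BV).
Qed.

Lemma graph_componentsE : V != finset.set0 ->
  graph_components e V = [set graph_class e V v | v in V]%SET.
Proof.
move=> /set0Pn[v0 v0V]; apply/setP => A; rewrite inE.
apply/maxsetP/imsetP => [[/andP[AV Aconn] Amax]|[v vV ->]]; last first.
  rewrite graph_class_sub graph_class_connected; split=> // B /andP[BV Bc] vB.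
  apply/eqP; rewrite finset.eqEsubset vB andbT.
  apply: graph_connected_sub_class => //.
  by rewrite (fintype.subsetP vB)// mem_graph_class.
have clsP v : A \subset graph_class e V v -> graph_class e V v = A.
  move=> Av; apply: Amax => //.
  by rewrite graph_class_sub graph_class_connected.
(* The empty set is vacuously connected, so its maximality has to be excluded: it would equal the
   class of [v0], which contains [v0]. *)
have [A0|/set0Pn[v vA]] := eqVneq A finset.set0; last first.
  exists v; first by rewrite (fintype.subsetP AV).
  by rewrite clsP//; exact: graph_connected_sub_class.
have := mem_graph_class v0V; rewrite clsP ?A0 ?finset.sub0set//.
by rewrite finset.in_set0.
Qed.

End GraphClasses.

(** * Counting classes that refine a finite partition *)

Lemma card_set_fin (S : finType) (A : {pred S}) : [set` A] #= `I_#|A|.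
Proof.
have -> : [set` A] = [set enum_val i | i in [set: 'I_#|A|]].
  apply/seteqP; split=> [x xA|_ [i _ <-]]; last exact: enum_valP.
  by exists (enum_rank_in xA x); rewrite ?enum_rankK_in.
apply: card_eq_trans (card_esym card_II).
by apply: inj_card_eq => i j _ _; exact: enum_val_inj.
Qed.

Lemma set_of_finset_inj (S : finType) (A B : {set S}) :
  [set` A] = [set` B] -> A = B.
Proof.
move=> /seteqP[AB BA]; apply/setP => x.
by apply/idP/idP; [exact: AB|exact: BA].
Qed.

Lemma card_eq_subset (T : Type) (A B : set T) (n : nat) :
  A #= `I_n -> B #= `I_n -> A `<=` B -> A = B.
Proof.
(* [fset_set] needs a choice structure, which [Ppointed] supplies once the empty type is set
   aside. *)
elim/Ppointed: T => T in A B *.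
  by rewrite !emptyE.
move=> An Bn AB.
have finA : finite_set A by apply/finite_setP; exists n.
have finB : finite_set B by apply/finite_setP; exists n.
rewrite -(fset_setK finA) -(fset_setK finB).
have /eqP -> // : fset_set A == fset_set B.
rewrite eqEfcard; apply/andP; split; first by rewrite -fset_set_sub.
by rewrite (card_fset_set An) (card_fset_set Bn).
Qed.

Section ClassesAndBlocks.
Variables (T : Type) (U : set T) (cls : T -> set T).
Variables (I : finType) (P : {set I}) (b : I -> set T).
Hypothesis cls_refl : forall x, U x -> cls x x.
Hypothesis b_neq0 : forall i, i \in P -> b i !=set0.
Hypothesis bU : forall i, i \in P -> b i `<=` U.
Hypothesis U_cover : forall x, U x -> exists2 i, i \in P & b i x.
Hypothesis b_disj : forall i j x, i \in P -> j \in P -> b i x -> b j x -> i = j.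
Hypothesis cls_sub : forall i x, i \in P -> b i x -> cls x `<=` b i.

(* One chosen point per block yields #|P| distinct classes, so there are exactly
   #|P| classes iff these are all of them. *)
Lemma card_classes_blocksP :
  [set cls x | x in U] #= `I_#|P| <->
  forall i x, i \in P -> b i x -> cls x = b i.
Proof.
pose S := {i | i \in P}.
have /choice[s sP] : forall i : S, exists x, b (val i) x.
  by move=> i; apply: b_neq0; exact: valP.
have sU i : U (s i) by apply: bU (sP i); exact: valP.
have clsb i : cls (s i) `<=` b (val i).
  by apply: cls_sub (sP i); exact: valP.
pose J := [set cls (s i) | i in [set` {: S}]].
have Jcard : J #= `I_#|P|.
  have -> : #|P| = #|{: S}| by rewrite card_sig; apply: eq_card.
  apply: card_eq_trans (card_set_fin {: S}); apply: inj_card_eq => i j _ _ ij.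
  apply: val_inj; apply: (b_disj (valP i) (valP j) (sP i)).
  by apply: clsb; rewrite -ij; exact: cls_refl.
have JC : J `<=` [set cls x | x in U] by move=> _ [i _ <-]; exists (s i).
split=> [Ccard i x iP bix|clsE].
  have JE := card_eq_subset Jcard Ccard JC.
  (* [J] is now the set of all classes, so the class of [y] is that of some [s j]; it contains [y]
     and lies in block [j], which forces [j = i]. *)
  have sameC y : b i y -> cls y = cls (s (exist _ i iP)).
    move=> biy; have : J (cls y) by rewrite JE; exists y => //; exact: bU biy.
    move=> [j _ jE]; rewrite -jE; congr (cls (s _)); apply: val_inj.
    apply: (b_disj (valP j) iP _ biy); apply: clsb; rewrite jE.
    by apply: cls_refl; exact: bU biy.
  apply/seteqP; split=> [|y biy]; first exact: cls_sub bix.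
  by rewrite (sameC _ bix) -(sameC _ biy); apply: cls_refl; exact: bU biy.
suff -> : [set cls x | x in U] = J by [].
apply/seteqP; split=> // _ [x Ux <-]; have [i iP bix] := U_cover Ux.
exists (exist _ i iP) => //.
by rewrite (clsE _ _ iP bix) (clsE _ _ iP (sP (exist _ i iP))).
Qed.

End ClassesAndBlocks.

(* Any two points of S are joined by a chain in S of steps smaller than e;
   phrased through sets closed under such steps to avoid handling chains. *)
Definition chain_connected (R : numDomainType) (T : pseudoMetricType R)
    (e : R) (S : set T) : Prop :=
  forall B : set T,
    (forall x y, S x -> S y -> ball x e y -> B x -> B y) ->
    forall x y, S x -> S y -> B x -> B y.

(** A nonempty relatively clopen [B] is compact and lies in an open [U] that meets [S] only in [B].
    By compactness one radius serves all of [B], and steps in [S] below that radius cannot leave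
    [B]. *)
Lemma chain_connected_compact (R : realType) (T : pseudoMetricType R)
    (S : set T) :
  compact S -> (forall e : R, 0 < e -> chain_connected e S) -> connected S.
Proof.
move=> cS chS B [x0 Bx0] [U oU BU] [C cC BC].
have cB : compact B by rewrite BC; exact: compact_closedI.
have B_U : \forall e \near (0:R)^'+, B `<=` (fun x => ball x e `<=` U).
  move: cB => /compact_near_coveringP; apply => x Bx.
  have : nbhs x U
    by apply: open_nbhs_nbhs; split=> //; move: Bx; rewrite BU => -[].
  move=> /nbhs_ballP[r /= r0 xU].
  (* Half of [r] pays for moving the centre from [x] to [y], the other half for the ball around
     [y]. *)
  exists (ball x (r / 2), [set e | e < r / 2]) => /=.
    split; first by apply: nbhsx_ballx; rewrite divr_gt0.
    by apply: nbhs_right_lt; rewrite divr_gt0.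
  move=> [y e] /= [xy er] z yz; apply: xU; rewrite [r]splitr.
  exact: ball_triangle xy (le_ball (ltW er) yz).
have [e [e0 eU]] : exists e : R, 0 < e /\ B `<=` (fun x => ball x e `<=` U).
  near (0:R)^'+ => e; exists e; split => //; near: e; exact: B_U.
have Bstep x y : S x -> S y -> ball x e y -> B x -> B y.
  by move=> _ Sy xy Bx; rewrite BU; split=> //; exact: eU xy.
have BS : B `<=` S by rewrite BU; exact: subIsetl.
apply/seteqP; split=> // y Sy.
exact: (chS e e0 B Bstep x0 y (BS _ Bx0) Sy Bx0).
Unshelve. all: by end_near. Qed.

(** * Tiles of the fractal square and the parts [F_A] *)

Section FractalSquareTiles.
Variables (R : realType) (N : nat).
Hypothesis hN : (2 <= N)%N.
Local Notation digit := ('I_N * 'I_N)%type.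

Lemma phi_ball (d : digit) (e : R) (x y : R * R) :
  ball x (e * N%:R) y -> ball (phi d x) e (phi d y).
Proof.
have N0 : 0 < N%:R :> R by rewrite ltr0n (leq_trans _ hN).
have dist (a b : R) (k : nat) : ball a (e * N%:R) b ->
    ball ((a + k%:R) / N%:R) e ((b + k%:R) / N%:R).
  rewrite /ball /= -mulrBl normrM normfV (gtr0_norm N0) ltr_pdivrMr//.
  by rewrite opprD addrACA subrr addr0.
by move=> [h1 h2]; split; exact: dist.
Qed.

Lemma phi_continuous (d : digit) : continuous (@phi R N d).
Proof.
move=> x; apply: (@cvg_pair _ _ _ _ (nbhs ((x.1 + (d.1 : nat)%:R) / N%:R))
  (nbhs ((x.2 + (d.2 : nat)%:R) / N%:R))).
  apply: cvgM; last exact: cvg_cst.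
  by apply: cvgD; [exact: cvg_fst|exact: cvg_cst].
apply: cvgM; last exact: cvg_cst.
by apply: cvgD; [exact: cvg_snd|exact: cvg_cst].
Qed.

Lemma compact_plane_closed (A : set (R * R)) : compact A -> closed A.
Proof. by apply: compact_closed; exact: norm_hausdorff. Qed.

Lemma compact_phi (d : digit) (A : set (R * R)) :
  compact A -> compact (phi d @` A).
Proof.
apply: continuous_compact; apply: continuous_subspaceT => x.
exact: phi_continuous.
Qed.

Variables (D : {set digit}) (F : set (R * R)).
Hypothesis D_neq0 : D != finset.set0.
Hypothesis F_square : is_fractal_square D F.

Local Notation DC := (digit_components D F).
Local Notation G := (level1_vertices D F).
Local Notation part A := (phi_image A F).
Local Notation tile v := (phi v.1 @` phi_image v.2 F).

Lemma F_compact : compact F. Proof. by case: F_square. Qed.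
Lemma F_neq0 : F !=set0. Proof. by case: F_square. Qed.
Lemma F_eq : F = phi_image D F. Proof. by case: F_square. Qed.

Lemma digit_adj_sym : symmetric (@digit_adj R N F).
Proof. by move=> d d'; rewrite /digit_adj setIC. Qed.

Lemma level1_adj_sym : symmetric (@level1_adj R N F).
Proof. by move=> u v; rewrite /level1_adj setIC. Qed.

Lemma digit_componentsE :
  DC = [set graph_class (@digit_adj R N F) D d | d in D]%SET.
Proof.
by rewrite /digit_components graph_componentsE//; exact: digit_adj_sym.
Qed.

Lemma digit_component_neq0 A : A \in DC -> exists d, d \in A.
Proof.
rewrite digit_componentsE => /imsetP[d dD ->].
by exists d; exact: mem_graph_class.
Qed.

Lemma digit_component_sub A d : A \in DC -> d \in A -> d \in D.
Proof.
rewrite digit_componentsE => /imsetP[d0 _ ->].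
exact/fintype.subsetP/graph_class_sub.
Qed.

Lemma digit_component_cover d : d \in D -> exists2 A, A \in DC & d \in A.
Proof.
move=> dD; exists (graph_class (@digit_adj R N F) D d).
  by rewrite digit_componentsE; apply: imset_f.
exact: mem_graph_class.
Qed.

(** An edge puts [d'] in the class of [d]. The disjointness of distinct parts rests on this. *)
Lemma digit_component_adj A B d d' : A \in DC -> B \in DC ->
  d \in A -> d' \in B -> digit_adj F d d' -> A = B.
Proof.
move=> ADC BDC dA d'B dd'.
have dD := digit_component_sub ADC dA; have d'D := digit_component_sub BDC d'B.
move: ADC BDC; rewrite digit_componentsE => /imsetP[a _ Aa] /imsetP[b _ Bb].
move: dA d'B; rewrite Aa Bb.
move=> /(graph_class_eq digit_adj_sym) <- /(graph_class_eq digit_adj_sym) <-.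
apply/esym/(graph_class_eq digit_adj_sym).
by rewrite inE d'D connect1// /induced_rel /= dD d'D.
Qed.

Lemma part_sub A : A \in DC -> part A `<=` F.
Proof.
move=> ADC x [d dA Fx]; rewrite F_eq; exists d => //.
exact: digit_component_sub ADC dA.
Qed.

Lemma part_compact A : A \in DC -> compact (part A).
Proof.
move=> ADC; apply: subclosed_compact F_compact (part_sub ADC).
apply: closed_bigcup => // d _; apply: compact_plane_closed.
exact: compact_phi F_compact.
Qed.

Lemma part_neq0 A : A \in DC -> part A !=set0.
Proof.
move=> /digit_component_neq0[d dA]; have [x Fx] := F_neq0.
by exists (phi d x), d => //; exists x.
Qed.

Lemma part_cover x : F x -> exists2 A, A \in DC & part A x.
Proof.
rewrite {1}F_eq => -[d /= dD Fx]; have [A ADC dA] := digit_component_cover dD.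
by exists A => //; exists d.
Qed.

Lemma part_disj A B x : A \in DC -> B \in DC -> part A x -> part B x -> A = B.
Proof.
move=> ADC BDC [d /= dA dx] [d' /= d'B d'x].
by apply: (digit_component_adj ADC BDC dA d'B); apply/asboolP; exists x.
Qed.

(** * Level-1 tiles and the blocks of the level-1 graph *)

Lemma tile_sub v (A : {set digit}) : v \in G -> v.1 \in A -> tile v `<=` part A.
Proof.
rewrite inE => /andP[_ v2] vA _ [x vx <-]; exists v.1 => //.
by exists x => //; exact: part_sub vx.
Qed.

Lemma tile_cover A x : A \in DC -> part A x ->
  exists2 v, v \in finset.setX A DC & tile v x.
Proof.
move=> ADC [d /= dA [y Fy <-]]; have [B BDC By] := part_cover Fy.
by exists (d, B); [rewrite inE dA BDC|exists y].
Qed.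

Lemma setX_component_sub A v :
  A \in DC -> v \in finset.setX A DC -> v \in G.
Proof.
move=> ADC; rewrite !inE => /andP[vA ->]; rewrite andbT.
exact: digit_component_sub ADC vA.
Qed.

(** The tile of [(d, B)] lies in the part of the component containing [d], and distinct parts are
    disjoint, so no edge joins two blocks. *)
Lemma level1_class_sub A v : A \in DC -> v \in finset.setX A DC ->
  graph_class (@level1_adj R N F) G v \subset finset.setX A DC.
Proof.
move=> ADC vA; apply/fintype.subsetP => w; rewrite inE => /andP[_ vw].
apply: (connect_invariant (Q := fun w => is_true (w \in finset.setX A DC))
  _ vw vA) => {vw w}u w uA.
rewrite /induced_rel /= => /and3P[uG wG /asboolP[x [ux wx]]].
move: (wG); rewrite !inE => /andP[w1 ->]; rewrite andbT.
have [B BDC wB] := digit_component_cover w1.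
suff -> : A = B by [].
have uA1 : u.1 \in A by move: uA; rewrite inE => /andP[].
by apply: (part_disj ADC BDC); [exact: tile_sub ux|exact: tile_sub wx].
Qed.

(** The graph count and the connectedness of all parts are each shown equivalent to this
    condition. *)
Definition level1_blocks : Prop := forall A v, A \in DC ->
  v \in finset.setX A DC ->
  graph_class (@level1_adj R N F) G v = finset.setX A DC.

(** One step of self-similarity: [phi] turns chains at scale [e * N] in a part into chains at scale
    [e] in a tile, and adjacent tiles share a point, so chains pass from tile to tile along a path
    in the block. *)
Lemma level1_chain_connected (e : R) : level1_blocks ->
  (forall A, A \in DC -> chain_connected (e * N%:R) (part A)) ->
  forall A, A \in DC -> chain_connected e (part A).
Proof.
move=> Gblocks IH A ADC B Bstep x y Ax Ay Bx.
have [v vA vx] := tile_cover ADC Ax; have [w wA wy] := tile_cover ADC Ay.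
have tileB u z z' : u \in finset.setX A DC ->
    tile u z -> tile u z' -> B z -> B z'.
  move=> uA [a ua <-] [a' ua' <-] Ba.
  have [u1 u2] : u.1 \in A /\ u.2 \in DC by move: uA; rewrite inE => /andP[].
  have uG := setX_component_sub ADC uA.
  (* The hypothesis is applied to the preimage of [B] under [phi u.1]. *)
  apply: (IH _ u2 (fun z => B (phi u.1 z)) _ a a' ua ua' Ba) => b b' ub ub' bb'.
  apply: Bstep; [| |exact: phi_ball].
    by apply: (tile_sub uG u1); exists b.
  by apply: (tile_sub uG u1); exists b'.
pose Q u := u \in finset.setX A DC /\ forall z, tile u z -> B z.
have vw : connect (induced_rel (@level1_adj R N F) G) v w.
  by move: wA; rewrite -(Gblocks A v ADC vA) inE => /andP[].
suff : Q w by case=> _; apply.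
apply: (connect_invariant _ vw); last by split=> // z vz; exact: tileB vx vz Bx.
move=> u u' [uA uB]; rewrite /induced_rel /= => /and3P[uG u'G uu'].
have u'A : u' \in finset.setX A DC.
  by rewrite -(Gblocks A u ADC uA) inE u'G connect1// /induced_rel /= uG u'G.
split=> // z u'z; move/asboolP: uu' => [t [ut u't]].
exact: tileB u'A u't u'z (uB _ ut).
Qed.

Lemma level1_blocks_connected :
  level1_blocks -> forall A, A \in DC -> connected (part A).
Proof.
move=> Gblocks A ADC; apply: chain_connected_compact; first exact: part_compact.
have [C [C0 hC]] : exists C : R, 0 < C /\ forall x y, F x -> F y -> ball x C y.
  have [M M0 FM] := ex_strict_bound_gt0 (compact_bounded F_compact).
  exists (M + M); split=> [|x y Fx Fy]; first exact: addr_gt0.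
  rewrite -ball_normE /=; apply: le_lt_trans (ler_normB _ _) _.
  by apply: ltrD; exact: FM.
(* [k] counts subdivisions. At [k = 0] a single step joins any two points, as [C <= e]. The scale
   [e] stays general because the induction hypothesis is used at [e * N]. *)
have main k : forall e : R, C <= e * N%:R ^+ k ->
    forall A, A \in DC -> chain_connected e (part A).
  elim: k => [|k IH] e Ce B BDC.
    move=> S Sstep x y Bx By; apply: Sstep => //.
    apply: (le_ball (e1 := C)); first by rewrite mulr1 in Ce.
    by apply: hC; exact: part_sub BDC _ _.
  apply: level1_chain_connected => //; apply: IH.
  by rewrite -mulrA -exprS.
(* [C / e] is below its natural bound [k], and [k < N ^ k] since [N >= 2]. *)
move=> e e0; apply: (main (Num.bound (C / e))) => //.
rewrite mulrC -ler_pdivrMr//; apply/ltW/(lt_le_trans (archi_boundP _)).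
  by rewrite divr_ge0// ltW.
by rewrite -natrX ler_nat ltnW// ltn_expl.
Qed.

(** If the class [C] of [v] missed a vertex of the block, the tiles over [C] and those over the rest
    [W] would split [part A] into two disjoint nonempty closed sets. *)
Lemma connected_level1_blocks :
  (forall A, A \in DC -> connected (part A)) -> level1_blocks.
Proof.
move=> Aconn A v ADC vA; apply/eqP.
rewrite finset.eqEsubset level1_class_sub//=.
apply/fintype.subsetP => w wA; apply: contrapT => /negP wv.
pose C := graph_class (@level1_adj R N F) G v.
pose W := (finset.setX A DC :\: C)%SET.
pose tiles (X : {set digit * {set digit}}) := \bigcup_(u in [set` X]) tile u.
have CA : C \subset finset.setX A DC by exact: level1_class_sub.
have WA : W \subset finset.setX A DC by exact: finset.subsetDl.
have tiles_closed (X : {set digit * {set digit}}) :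
    X \subset finset.setX A DC -> closed (tiles X).
  move=> /fintype.subsetP XA; apply: closed_bigcup => // u /XA.
  rewrite inE => /andP[_ u2]; apply: compact_plane_closed.
  exact: compact_phi (part_compact u2).
have tiles_sub (X : {set digit * {set digit}}) :
    X \subset finset.setX A DC -> tiles X `<=` part A.
  move=> /fintype.subsetP XA z [u /= /XA uA uz].
  apply: (tile_sub (setX_component_sub ADC uA) _ uz).
  by move: uA; rewrite inE => /andP[].
(* A common point would be an edge from [C] to a vertex of [W], putting that vertex in [C]. *)
have tilesCW z : tiles C z -> ~ tiles W z.
  move=> [u /= uC uz] [u' /= + u'z]; rewrite inE => /andP[/negP + u'A]; apply.
  have u'G := setX_component_sub ADC u'A.
  move: uC; rewrite /C inE => /andP[uG vu]; rewrite inE u'G /=.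
  apply: connect_trans vu (connect1 _); rewrite /induced_rel /= uG u'G /=.
  by apply/asboolP; exists z.
have tile_neq0 (u : digit * {set digit}) :
    u \in finset.setX A DC -> tile u !=set0.
  rewrite inE => /andP[_ /part_neq0[z uz]].
  by exists (phi u.1 z), z.
have CE : tiles C = part A.
  apply: (Aconn A ADC).
  - have [z vz] := tile_neq0 _ vA; exists z, v => //=.
    by apply: mem_graph_class; exact: setX_component_sub vA.
  - exists (~` tiles W); first by rewrite openC; exact: tiles_closed.
    apply/seteqP; split=> z.
      by move=> Cz; split; [exact: tiles_sub Cz|exact: tilesCW].
    move=> [Az Wz]; have [u uA uz] := tile_cover ADC Az.
    have [uC|uC] := boolP (u \in C); first by exists u.
    by case: Wz; exists u => //=; rewrite finset.in_setD uC.
  - exists (tiles C); first exact: tiles_closed.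
    by apply/esym/setIidPr; exact: tiles_sub.
have [z wz] := tile_neq0 _ wA.
have wW : w \in W by rewrite finset.in_setD wA andbT.
apply: (tilesCW z); last by exists w.
by rewrite CE; apply: (tiles_sub W WA); exists w.
Qed.

(** * Counting connected components and graph components *)

Lemma component_sub_part A x :
  A \in DC -> part A x -> connected_component F x `<=` part A.
Proof.
move=> ADC Ax; have Fx := part_sub ADC Ax.
(* The other parts are finitely many closed sets, so [part A] is open as well as closed in [F], and
   its nonempty trace on the component is the whole component. *)
pose rest := \bigcup_(B in [set` (DC :\ A)%SET]) part B.
suff <- : connected_component F x `&` part A = connected_component F x.
  exact: subIsetr.
apply: component_connected.
- by exists x; split=> //; exact: connected_component_refl.
- exists (~` rest).
    rewrite openC; apply: closed_bigcup => // B /=.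
    rewrite finset.in_setD1 => /andP[_ BDC].
    exact: compact_plane_closed (part_compact BDC).
  apply/seteqP; split=> y [Cy hy]; split=> //.
    move=> [B /=]; rewrite finset.in_setD1 => /andP[/eqP BA BDC] By; apply: BA.
    exact: part_disj BDC ADC By hy.
  have [B BDC By] := part_cover (connected_component_sub Cy).
  have [<-//|BA] := eqVneq B A.
  by case: hy; exists B => //=; rewrite finset.in_setD1 BA.
- by exists (part A) => //; exact: compact_plane_closed (part_compact ADC).
Qed.

(** By the counting lemma the count says that the component of each point is its whole part; as
    components never exceed parts, this is connectedness of the parts. *)
Lemma card_componentsP : components F #= `I_#|DC| <->
  forall A, A \in DC -> connected (part A).
Proof.
apply: (iff_trans (card_classes_blocksP (b := fun A => part A) _ _ _ _ _ _)).
- by move=> x; exact: connected_component_refl.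
- by move=> A; exact: part_neq0.
- by move=> A; exact: part_sub.
- by move=> x; exact: part_cover.
- by move=> A B x; exact: part_disj.
- by move=> A x; exact: component_sub_part.
split=> [compE A ADC|Aconn A x ADC Ax].
  have [x Ax] := part_neq0 ADC; rewrite -(compE A x ADC Ax).
  exact: component_connected.
apply/seteqP; split; first exact: component_sub_part.
by apply: connected_component_max => //; [exact: part_sub|exact: Aconn].
Qed.

Lemma level1_vertices_neq0 : G != finset.set0.
Proof.
have /set0Pn[d dD] := D_neq0; have [A ADC dA] := digit_component_cover dD.
by apply/set0Pn; exists (d, A); rewrite inE dD.
Qed.

Lemma card_level1_componentsP :
  #|level1_components D F| = #|DC| <-> level1_blocks.
Proof.
pose cls v := [set` graph_class (@level1_adj R N F) G v].
(* The finite-set cardinality is restated for a set of classes, so that the same counting lemma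
   applies to the graph. *)
have clsE : [set cls v | v in [set` G]] #= `I_#|level1_components D F|.
  apply: card_eq_trans (card_set_fin _).
  have -> : [set cls v | v in [set` G]] =
      [set [set` B] | B in [set` level1_components D F]].
    rewrite /level1_components graph_componentsE; last 2 first.
    - exact: level1_adj_sym.
    - exact: level1_vertices_neq0.
    apply/seteqP; split=> X.
      move=> [v vG <-]; exists (graph_class (@level1_adj R N F) G v) => //=.
      exact: imset_f.
    by move=> [B /imsetP[v vG ->] <-]; exists v.
  by apply: inj_card_eq => B C _ _; exact: set_of_finset_inj.
have -> : (#|level1_components D F| = #|DC|) <->
    [set cls v | v in [set` G]] #= `I_#|DC|.
  by rewrite (card_eql clsE); split=> /card_eq_II.
apply: (iff_trans (card_classes_blocksP
  (b := fun A => [set` finset.setX A DC]) _ _ _ _ _ _)).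
- by move=> v; exact: mem_graph_class.
- move=> A ADC; have [d dA] := digit_component_neq0 ADC.
  by exists (d, A); rewrite /= inE dA.
- by move=> A ADC v; exact: setX_component_sub.
- move=> v /=; rewrite inE => /andP[v1 v2].
  have [A ADC vA] := digit_component_cover v1.
  by exists A => //=; rewrite inE vA.
- move=> A B v ADC BDC /=; rewrite !inE => /andP[vA _] /andP[vB _].
  (* A digit in both [A] and [B] puts the point [phi v.1 x] in both parts, so disjointness of the
     parts gives [A = B]. *)
  have [x Fx] := F_neq0.
  by apply: (part_disj (x := phi v.1 x) ADC BDC); exists v.1 => //; exists x.
- by move=> A v ADC vA u; apply/fintype.subsetP; exact: level1_class_sub.
split=> [clsb A v ADC vA|blocks A v ADC vA]; last first.
  by rewrite /cls (blocks A v ADC vA).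
exact: set_of_finset_inj (clsb A v ADC vA).
Qed.

End FractalSquareTiles.

Theorem theorem1p4 (R : realType) (N : nat) (hN : (2 <= N)%N)
    (D : {set 'I_N * 'I_N}) (hD : D != finset.set0)
    (F : set (R * R)) (hF : is_fractal_square D F)
    (hm : (2 <= #|digit_components D F|)%N) :
  components F #= `I_#|digit_components D F| <->
  #|level1_components D F| = #|digit_components D F|.
Proof.
apply: (iff_trans (card_componentsP hD hF)).
apply: (iff_trans _ (iff_sym (card_level1_componentsP hD hF))).
split=> [|blocks A ADC]; first exact: (connected_level1_blocks hD hF).
exact: (level1_blocks_connected hN hD hF blocks ADC).
Qed.
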